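(* For every integer $d \ge 1$, every graph that does not contain the complete graph $K_d$ as a minor has distance $2$VC-dimension at most $d-1$.
   Context: All graphs are finite and simple. For a graph $G=(V,E)$ and vertices $x,y$, $d_G(x,y)$ is the length of a shortest $xy$-path ($+\infty$ if none), and $B_G(x,k)=\{y\in V: d_G(x,y)\le k\}$ is the ball of center $x$ and radius $k$. The $B$-hypergraph of $G$ has vertex set $V$ and hyperedges all balls $B_G(v,k)$ for $v\in V$ and integers $k\ge 0$. In a hypergraph, a set $X$ of vertices is $2$-shattered if for every subset $X'\subseteq X$ with $|X'|=2$ there is a hyperedge $e$ with $e\cap X=X'$; the $2$VC-dimension of the hypergraph is the maximum size of a $2$-shattered set. The distance $2$VC-dimension of a graph $G$ is the maximum, over all induced subgraphs $G'$ of $G$, of the $2$VC-dimension of the $B$-hypergraph of $G'$ (distances computed in $G'$). A graph $H$ is a minor of $G$ if $H$ can be obtained from $G$ by deleting vertices, deleting edges and contracting edges. *)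

(* Defs.v *)
From mathcomp Require Import all_boot.
From mathcomp Require Import boolp.

Set Implicit Arguments.
Unset Strict Implicit.
Unset Printing Implicit Defensive.

Record sgraph := SGraph {
  svertex :> finType;
  sedge : rel svertex;
  sedge_sym : symmetric sedge;
  sedge_irrefl : irreflexive sedge }.

Definition complete_rel (d : nat) : rel 'I_d := fun u v => u != v.

Lemma complete_sym d : symmetric (@complete_rel d).
Proof. by move=> u v; rewrite /complete_rel eq_sym. Qed.

Lemma complete_irrefl d : irreflexive (@complete_rel d).
Proof. by move=> u; rewrite /complete_rel eqxx. Qed.

Definition complete_graph (d : nat) : sgraph :=
  SGraph (@complete_sym d) (@complete_irrefl d).

Section Constructions.
Variable G : sgraph.

Definition induced_rel (S : {set G}) : rel {v : G | v \in S} :=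
  fun u v => sedge (val u) (val v).

Lemma induced_sym S : symmetric (@induced_rel S).
Proof. by move=> u v; rewrite /induced_rel sedge_sym. Qed.

Lemma induced_irrefl S : irreflexive (@induced_rel S).
Proof. by move=> u; rewrite /induced_rel sedge_irrefl. Qed.

Definition induced (S : {set G}) : sgraph :=
  SGraph (@induced_sym S) (@induced_irrefl S).

Definition del_vertex (x : G) : sgraph := induced [set~ x].

Definition del_edge_rel (x y : G) : rel G :=
  fun u v => sedge u v && ([set u; v] != [set x; y]).

Lemma del_edge_sym x y : symmetric (del_edge_rel x y).
Proof. by move=> u v; rewrite /del_edge_rel sedge_sym setUC. Qed.

Lemma del_edge_irrefl x y : irreflexive (del_edge_rel x y).
Proof. by move=> u; rewrite /del_edge_rel sedge_irrefl. Qed.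

Definition del_edge (x y : G) : sgraph :=
  SGraph (del_edge_sym x y) (del_edge_irrefl x y).

(* Contraction of [xy]: the merged vertex is represented by [x], and [y] is
   removed from the vertex set; loops and multiple edges are suppressed. *)
Definition contract_rel (x y : G) : rel {v : G | v \in [set~ y]} :=
  fun u v => (u != v) &&
    [|| sedge (val u) (val v),
        (val u == x) && sedge y (val v)
      | (val v == x) && sedge y (val u)].

Lemma contract_sym x y : symmetric (@contract_rel x y).
Proof.
by move=> u v; rewrite /contract_rel eq_sym sedge_sym [X in _ || X]orbC.
Qed.

Lemma contract_irrefl x y : irreflexive (@contract_rel x y).
Proof. by move=> u; rewrite /contract_rel eqxx. Qed.

Definition contract (x y : G) : sgraph :=
  SGraph (@contract_sym x y) (@contract_irrefl x y).

End Constructions.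

Definition sgraph_iso (H G : sgraph) : Prop :=
  exists2 f : H -> G, bijective f & forall u v, sedge (f u) (f v) = sedge u v.

Inductive minor (H : sgraph) : sgraph -> Prop :=
| minor_iso (G : sgraph) : sgraph_iso H G -> minor H G
| minor_del_vertex (G : sgraph) (x : G) : minor H (del_vertex x) -> minor H G
| minor_del_edge (G : sgraph) (x y : G) :
    sedge x y -> minor H (del_edge x y) -> minor H G
| minor_contract (G : sgraph) (x y : G) :
    sedge x y -> minor H (contract x y) -> minor H G.

Section Hypergraph.
Variable T : finType.

(* A hypergraph on [T] is given by its set of hyperedges. *)
Definition shattered2 (E : {set {set T}}) (X : {set T}) : bool :=
  [forall Y : {set T}, (Y \subset X) && (#|Y| == 2) ==>
    [exists e in E, e :&: X == Y]].

Definition vcdim2 (E : {set {set T}}) : nat :=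
  \max_(X : {set T} | shattered2 E X) #|X|.

End Hypergraph.

Section Distance.
Variable G : sgraph.

Definition has_path_of_length (x y : G) (n : nat) : bool :=
  [exists p : n.-tuple G,
    [&& path (@sedge G) x p, last x p == y & uniq (x :: p)]].

(* [None] stands for +oo; a path has length less than [#|G|], so the smallest
   length of a path is the head of this increasing list. *)
Definition dist (x y : G) : option nat :=
  ohead [seq n <- iota 0 #|G| | has_path_of_length x y n].

Definition ball (x : G) (k : nat) : {set G} :=
  [set y | if dist x y is Some n then n <= k else false].

Definition B_hypergraph : {set {set G}} :=
  [set B | `[< exists (v : G) (k : nat), B = ball v k >]].

End Distance.

Definition distance_vcdim2 (G : sgraph) : nat :=
  \max_(S : {set G}) vcdim2 (B_hypergraph (induced S)).

(* Main.v *)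
(* If the points x_i are 2-shattered, their Voronoi cells (ties broken by index)
   are the branch sets of a complete minor. Cells are connected because moving
   from u one step towards its nearest point keeps u in the same cell. Let the
   ball B(c, r) contain x_i and x_j only. If u lies on a shortest path from c to
   x_i or x_j, then the point nearest to u also lies in B(c, r), so u is in the
   cell of x_i or of x_j; the path from x_i through c to x_j therefore has an
   edge between these two cells. *)
Require Import Defs.
From mathcomp Require Import all_boot.
From mathcomp Require Import boolp zify.

Set Implicit Arguments.
Unset Strict Implicit.
Unset Printing Implicit Defensive.

(** * Walks, balls and truncated distances *)

Section Walks.
Variable G : sgraph.
Implicit Types (x y z : G) (k m n : nat).

Lemma has_path_lt x y n : has_path_of_length x y n -> n < #|G|.
Proof.
case/existsP=> p /and3P[_ _ /card_uniqP /= cp].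
by have := max_card (mem (x :: p)); rewrite cp size_tuple.
Qed.

Lemma ballP x y k :
  reflect (exists p, [/\ path (@sedge G) x p, last x p = y & size p <= k])
          (y \in ball x k).
Proof.
rewrite inE /dist; set s := [seq n <- _ | _].
have s_sorted : sorted leq s by apply: sorted_filter (iota_sorted _ _); apply: leq_trans.
have s_mem n : (n \in s) = has_path_of_length x y n.
  rewrite mem_filter mem_iota /= add0n; case h: has_path_of_length => //=.
  exact: has_path_lt h.
apply: (iffP idP).
  case: s s_mem {s_sorted} => //= n s s_mem nk.
  have := s_mem n; rewrite mem_head => /esym/existsP[p /and3P[pp /eqP lp _]].
  by exists p; rewrite size_tuple.
case=> p [pp lp sp]; case/shortenP: pp lp => p' pp' up' sub lp.
have sp' : size p' <= size p by apply: uniq_leq_size => //; case/andP: up'.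
have : size p' \in s.
  by rewrite s_mem; apply/existsP; exists (in_tuple p'); rewrite pp' lp eqxx.
case: s s_sorted {s_mem} => //= n s /(order_path_min leq_trans)/allP s_min.
have p_k := leq_trans sp' sp; rewrite inE /= => /predU1P[<- //|/s_min n_p]; exact: leq_trans n_p p_k.
Qed.

Lemma ball_center x k : x \in ball x k.
Proof. by apply/ballP; exists [::]. Qed.

Lemma ball0 x y : y \in ball x 0 -> y = x.
Proof. by case/ballP=> -[|z p] [_ /= <-]. Qed.

Lemma ball_leq x y m n : m <= n -> y \in ball x m -> y \in ball x n.
Proof. by move=> mn /ballP[p [pp lp sp]]; apply/ballP; exists p; split=> //; lia. Qed.

Lemma ball_trans x y z m n :
  y \in ball x m -> z \in ball y n -> z \in ball x (m + n).
Proof.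
move=> /ballP[p [pp lp sp]] /ballP[q [pq lq sq]]; apply/ballP; exists (p ++ q).
by rewrite cat_path last_cat size_cat lp pp; split=> //; lia.
Qed.

Lemma ball_edge x y : sedge x y -> y \in ball x 1.
Proof. by move=> xy; apply/ballP; exists [:: y]; rewrite /= xy. Qed.

Lemma ball_step x y n : y \in ball x n.+1 ->
  y = x \/ exists2 z, sedge x z & y \in ball z n.
Proof.
case/ballP=> -[|z p] [/= pp lp sp]; first by left.
by case/andP: pp => xz pz; right; exists z => //; apply/ballP; exists p.
Qed.

(* Infinite distances are replaced by [#|G|]. *)
Definition tdist x y : nat := odflt #|G| (dist x y).

(** The second conjunct excludes the stand-in for an infinite distance when [k >= #|G|]. *)
Lemma mem_ball x y k : (y \in ball x k) = (tdist x y <= k) && (tdist x y < #|G|).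
Proof.
rewrite inE /tdist; case E: (dist x y) => [n|] /=; last by rewrite ltnn andbF.
suff -> : n < #|G| by rewrite andbT.
move: E; rewrite /dist; case s_def: [seq n <- _ | _] => [//|m s] /= [<-].
have : m \in m :: s by rewrite mem_head.
by rewrite -s_def mem_filter mem_iota => /andP[_] /andP[].
Qed.

Lemma tdist_edge x y z : sedge x z -> tdist x y <= (tdist z y).+1.
Proof.
move=> /ball_edge xz; have xy : tdist x y <= #|G|.
  rewrite leqNgt; apply/negP => gt; move: gt.
  have := mem_ball x y (tdist x y).
  rewrite inE /tdist; case: (dist x y) => [n|] /=; last by rewrite ltnn.
  by rewrite leqnn /= => /esym; lia.
(* If [z] does not reach [y], the right-hand side exceeds [#|G|], which bounds [tdist x y]. *)
have [lt|ge] := ltnP (tdist z y) #|G|; last by lia.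
have zy : y \in ball z (tdist z y) by rewrite mem_ball leqnn.
by have := ball_trans xz zy; rewrite mem_ball => /andP[].
Qed.

End Walks.

(** * Models of complete graphs and the minors they yield *)

Section Models.

Definition cell_rel (G : sgraph) (I : eqType) (f : G -> option I) : rel G :=
  fun u v => [&& sedge u v, f u == f v & f u != None].

Lemma cell_rel_sym (G : sgraph) (I : eqType) (f : G -> option I) :
  symmetric (cell_rel f).
Proof.
by move=> u v; rewrite /cell_rel sedge_sym eq_sym; case: eqP => // ->.
Qed.

(* The branch set of [i] is the preimage of [Some i]; [None] marks the vertices
   that belong to no branch set. *)
Record complete_model (d : nat) (G : sgraph) (f : G -> option 'I_d) : Prop := {
  model_nonempty : forall i, exists u, f u = Some i;
  model_connected : forall u v,
    f u = f v -> f u != None -> connect (cell_rel f) u v;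
  model_adjacent : forall i j, i != j ->
    exists u v, [/\ f u = Some i, f v = Some j & sedge u v] }.

(** Edges may be sent to walks, possibly empty, which allows maps that collapse edges. *)
Lemma connect_homo (T T' : finType) (e : rel T) (e' : rel T') (h : T -> T') :
  (forall u v, e u v -> connect e' (h u) (h v)) ->
  forall u v, connect e u v -> connect e' (h u) (h v).
Proof.
move=> he u v /connectP[p]; elim: p u => [|w p IH] u /=; first by move=> _ ->.
by case/andP=> /he uw /IH{}IH /IH; apply: connect_trans.
Qed.

Variable d : nat.

Lemma model_induced (G : sgraph) (S : {set G}) (f : induced S -> option 'I_d) :
  complete_model f -> exists g : G -> option 'I_d, complete_model g.
Proof.
case=> ne co ad; pose g v := oapp f None (insub v : option (induced S)).
have gE v : g (val v) = f v by rewrite /g valK.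
have gN v : g v != None -> exists2 w : induced S, v = val w & g v = f w.
  by rewrite /g; case: insubP => //= w _ <-; exists w.
exists g; split.
- by move=> i; have [u fu] := ne i; exists (val u); rewrite gE.
- move=> u v uv gu; have gv : g v != None by rewrite -uv.
  have [u' uE eu] := gN u gu; have [v' vE ev] := gN v gv; rewrite uE vE.
  apply: (@connect_homo _ _ (cell_rel f) _ val).
    by move=> a b ab; apply: connect1; rewrite /cell_rel !gE.
  by apply: co; rewrite -eu // uv.
- move=> i j /ad[u [v [fu fv uv]]].
  by exists (val u), (val v); rewrite !gE.
Qed.

Lemma model_del_vertex (G : sgraph) (x : G) (f : G -> option 'I_d) :
  f x = None -> complete_model f ->
  complete_model (fun v : del_vertex x => f (val v)).
Proof.
move=> fx [ne co ad].
have lift v : f v != None -> exists v' : del_vertex x, val v' = v.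
  move=> fv; have vS : v \in [set~ x].
    by rewrite !inE; apply: contra_neq fv => ->.
  by exists (Sub v vS).
split.
- move=> i; have [u fu] := ne i; have [|u' eu] := lift u; first by rewrite fu.
  by exists u'; rewrite eu.
- move=> u v uv fu; rewrite -[u](valKd u) -[v](valKd u).
  (* Both ends of an edge of [cell_rel f] carry a label, so they differ from [x] and [insubd u] does
     not fall back on [u] there. *)
  apply: (@connect_homo _ _ (cell_rel f) _ (insubd u)); last exact: co.
  move=> a b /and3P[ab eab fa]; have fb : f b != None by rewrite -(eqP eab).
  have [a' ea] := lift a fa; have [b' eb] := lift b fb.
  rewrite -ea -eb !valKd; apply: connect1.
  by rewrite /cell_rel ea eb eab fa !andbT /= /induced_rel ea eb.
- move=> i j /ad[u [v [fu fv uv]]].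
  have [|u' eu] := lift u; first by rewrite fu.
  have [|v' ev] := lift v; first by rewrite fv.
  by exists u', v'; rewrite eu ev; split=> //=; rewrite /induced_rel eu ev.
Qed.

Lemma model_contract (G : sgraph) (x y : G) (f : G -> option 'I_d) :
  sedge x y -> f x = f y -> complete_model f ->
  complete_model (fun v : contract x y => f (val v)).
Proof.
move=> xy fxy [ne co ad].
have xS : x \in [set~ y].
  by rewrite !inE; apply: contraTneq xy => ->; rewrite sedge_irrefl.
(* [h] is the contraction map: the default [x'] is taken exactly at [y]. *)
pose x' : contract x y := Sub x xS; pose h v : contract x y := insubd x' v.
have hE v : val (h v) = if v == y then x else v.
  by rewrite /h val_insubd !inE; case: (v == y).
have fh v : f (val (h v)) = f v by rewrite hE; case: eqP => // ->.
have hK v : h (val v) = v by rewrite /h valKd.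
have h_edge u v : sedge u v -> h u = h v \/ sedge (h u) (h v).
  move=> uv; case: (eqVneq (h u) (h v)) => [|huv]; [by left | right].
  rewrite /= /contract_rel huv /= !hE.
  case: (eqVneq u y) uv => [->|_]; case: (eqVneq v y) => [->|_] uv.
  - by rewrite sedge_irrefl in uv.
  - by rewrite eqxx uv orbT.
  - by rewrite eqxx sedge_sym in uv *; rewrite uv !orbT.
  - by rewrite uv.
split.
- by move=> i; have [u fu] := ne i; exists (h u); rewrite fh.
- move=> u v uv fu; rewrite -[u]hK -[v]hK.
  apply: (@connect_homo _ _ (cell_rel f) _ h); last exact: co.
  move=> a b /and3P[ab eab fa]; case: (h_edge _ _ ab) => [->|hab] //.
  by apply: connect1; rewrite /cell_rel hab !fh eab.
- move=> i j ij; have [u [v [fu fv uv]]] := ad i j ij.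
  exists (h u), (h v); rewrite !fh; split=> //.
  case: (h_edge _ _ uv) => // e; move: ij.
  have : Some i = Some j by rewrite -fu -fv -fh e fh.
  by case=> ->; rewrite eqxx.
Qed.

(** Induction on the number of vertices: delete an unlabelled vertex or contract an edge inside a
    branch set. When neither exists, the branch sets are single vertices and [G] is complete. *)
Lemma complete_model_minor (G : sgraph) (f : G -> option 'I_d) :
  complete_model f -> minor (complete_graph d) G.
Proof.
have [n] := ubnP #|G|; elim: n G f => // n IH G f ltGn mf.
have card_lt (x : G) : #|{: {v : G | v \in [set~ x]}}| < n.
  have Gx : 0 < #|G| by apply/card_gt0P; exists x.
  by rewrite card_sig (eq_card (B := [set~ x])) // cardsC1 prednK.
have [/existsP[x /eqP fx]|/existsPn total] := boolP [exists x, f x == None].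
  by apply: (@minor_del_vertex _ _ x); apply: (IH (del_vertex x) _ (card_lt x) (model_del_vertex fx mf)).
have [/existsP[x /existsP[y /andP[xy /eqP fxy]]]|proper] :=
  boolP [exists x, exists y, sedge x y && (f x == f y)].
  by apply: (minor_contract xy); apply: (IH (contract x y) _ (card_lt y) (model_contract xy fxy mf)).
(* A nonempty walk inside a branch set would start with an edge whose ends share a label. *)
have f_inj : injective f.
  move=> u v uv; have := model_connected mf uv (total u).
  case/connectP=> -[|w p] //= /andP[/and3P[uw fuw _] _] _.
  by case/existsP: proper; exists u; apply/existsP; exists w; rewrite uw.
case: mf => ne _ ad; apply: minor_iso.
have ex_g i : exists u, f u == Some i by have [u fu] := ne i; exists u; apply/eqP.
have ex_h u : exists i, f u == Some i.
  by have := total u; case: (f u) => [i|//] _; exists i.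
pose g i := xchoose (ex_g i); pose h u := xchoose (ex_h u).
have gE i : f (g i) = Some i by apply/eqP/(xchooseP (ex_g i)).
have hE u : f u = Some (h u) by apply/eqP/(xchooseP (ex_h u)).
exists g; first exists h => [i|u].
- by apply: Some_inj; rewrite -hE gE.
- by apply: f_inj; rewrite gE hE.
- move=> i j; rewrite [RHS]/=/complete_rel; case: eqVneq => [->|/ad[u [v [fu fv uv]]]].
    by rewrite sedge_irrefl.
  have -> : g i = u by apply: f_inj; rewrite gE.
  by have -> : g j = v by apply: f_inj; rewrite gE.
Qed.

End Models.

(** * Voronoi cells as branch sets *)

Section Voronoi.
Variables (d : nat) (G : sgraph) (x : 'I_d -> G).
Hypothesis x_inj : injective x.

(* Orders the points lexicographically by distance to [u], then by index. *)
Definition vkey (u : G) (i : 'I_d) : nat := tdist u (x i) * d + i.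

(** The bound [#|G|] leaves a vertex that reaches no point without a cell; the index in [vkey] makes
    the minimiser unique. *)
Definition vcell (u : G) : option 'I_d :=
  [pick i | (tdist u (x i) < #|G|) && [forall j, vkey u i <= vkey u j]].

(** Indices are below [d], so they cannot outweigh a difference in distance. *)
Lemma vkey_tdist u i j : vkey u i <= vkey u j -> tdist u (x i) <= tdist u (x j).
Proof. by rewrite /vkey; have := ltn_ord i; have := ltn_ord j; nia. Qed.

Lemma vcellP u i :
  reflect (tdist u (x i) < #|G| /\ forall j, vkey u i <= vkey u j)
          (vcell u == Some i).
Proof.
rewrite /vcell; apply: (iffP eqP).
  by case: pickP => // k /andP[? /forallP ?] [<-].
case=> fin_i min_i; case: pickP => [k /andP[_ /forallP min_k]|/(_ i)]; last first.
  by rewrite fin_i => /negP[]; apply/forallP.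
have := min_k i; have := min_i k => ik ki.
have e : tdist u (x i) = tdist u (x k).
  by apply/eqP; rewrite eqn_leq !vkey_tdist.
by congr Some; apply/val_inj => /=; move: ik ki; rewrite /vkey e; lia.
Qed.

(** The point with the least key is no farther from [u] than [x i]. *)
Lemma vcell_reach u i n : x i \in ball u n ->
  exists2 k, vcell u = Some k & x k \in ball u n.
Proof.
rewrite mem_ball => /andP[le_n fin_i].
case: (arg_minnP (vkey u) (isT : predT i)) => k _ min_k.
have ki : tdist u (x k) <= tdist u (x i) by apply/vkey_tdist/min_k.
exists k; last by rewrite mem_ball; lia.
by apply/eqP/vcellP; split=> [|j]; [lia | apply: min_k].
Qed.

Lemma vcell_center i : vcell (x i) = Some i.
Proof.
have [k -> /ball0/x_inj ->] // := vcell_reach (ball_center (x i) 0).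
Qed.

Lemma vcell_connect_center u i :
  vcell u = Some i -> connect (cell_rel vcell) u (x i).
Proof.
have [n] := ubnP (tdist u (x i)); elim: n u => // n IH u lt_n ui.
have /eqP/vcellP[fin_i min_i] := ui.
have : x i \in ball u (tdist u (x i)) by rewrite mem_ball leqnn.
case E: (tdist u (x i)) => [|m]; first by move/ball0 => ->.
case/ball_step => [->//|[w uw]]; rewrite mem_ball => /andP[wm fin_w].
(* From [u] to [w] the key of [i] drops by at least [d], any other key by at most [d], so [i] stays
   minimal. *)
have wi : vcell w = Some i.
  apply/eqP/vcellP; split=> // j; have := min_i j; have := tdist_edge (x j) uw.
  by rewrite /vkey E; nia.
apply: connect_trans (IH w _ wi); last by lia.
by apply: connect1; rewrite /cell_rel uw ui wi eqxx.
Qed.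

Lemma vcell_adjacent c r i j : i != j ->
  (forall k, (x k \in ball c r) = (k == i) || (k == j)) ->
  exists u v, [/\ vcell u = Some i, vcell v = Some j & sedge u v].
Proof.
move=> ij cr; apply: contrapT => no_edge.
(* A walk of length at most [m + n] leads from [c] through [u] to the point nearest to [u], which
   therefore lies in the ball. *)
have in_ij u k m n : u \in ball c m -> x k \in ball u n -> m + n <= r ->
    vcell u = Some i \/ vcell u = Some j.
  move=> cu uk mn; have [l -> ul] := vcell_reach uk.
  have : x l \in ball c r by apply: ball_leq mn (ball_trans cu ul).
  by rewrite cr => /orP[]/eqP ->; [left | right].
(* Without an edge between the cells, a cell met by a path from [c] within
   the ball contains the whole path. *)
have along k n u m : k \in [:: i; j] -> u \in ball c m -> x k \in ball u n ->
    m + n <= r -> vcell u = Some k.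
  move=> kij; elim: n u m => [|n IH] u m cu uk mn.
    by rewrite -(ball0 uk) vcell_center.
  case: (ball_step uk) => [<-|[w uw wk]]; first exact: vcell_center.
  have wE : vcell w = Some k.
    by apply: (IH w m.+1) => //; [rewrite -addn1; apply: ball_trans cu (ball_edge uw) | lia].
  (* If [u] had the other label, [uw] would be an edge between the two cells. *)
  have := in_ij u k m n.+1 cu uk mn; move: kij wE; rewrite !inE.
  case/orP=> /eqP -> wE [] uE //; case: no_edge; first by exists w, u; rewrite sedge_sym.
  by exists u, w.
(* Following walks to both points puts [c] itself in two different cells. *)
have ci : vcell c = Some i.
  by apply: along (mem_head i _) (ball_center c 0) _ (leqnn r); rewrite cr eqxx.
have cj : vcell c = Some j.
  by apply: along (mem_last i [:: j]) (ball_center c 0) _ (leqnn r); rewrite cr eqxx orbT.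
by case: ci ij; rewrite cj => -[->]; rewrite eqxx.
Qed.

Lemma vcell_model :
  (forall i j, i != j -> exists c r, forall k,
     (x k \in ball c r) = (k == i) || (k == j)) ->
  complete_model vcell.
Proof.
move=> shattered; split.
- by move=> i; exists (x i); apply: vcell_center.
- move=> u v uv; case ui: (vcell u) => [i|//] _.
  apply: connect_trans (vcell_connect_center ui) _.
  rewrite (sym_connect_sym (cell_rel_sym vcell)); apply: vcell_connect_center.
  by rewrite -uv.
- by move=> i j ij; have [c [r cr]] := shattered i j ij; apply: vcell_adjacent cr.
Qed.

End Voronoi.

(** * From shattered sets to complete minors *)

Lemma shattered2_model (G : sgraph) (X : {set G}) (d : nat) :
  shattered2 (B_hypergraph G) X -> d <= #|X| ->
  exists f : G -> option 'I_d, complete_model f.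
Proof.
move=> /forallP shX dX.
(* Any [d] points of [X] suffice; the first [d] in its enumeration are taken. *)
pose x (i : 'I_d) : G := enum_val (widen_ord dX i).
have x_inj : injective x by move=> i j /enum_val_inj/(congr1 val)/= /val_inj.
have xX i : x i \in X by apply: enum_valP.
exists (vcell x); apply: vcell_model => // i j ij.
have := shX [set x i; x j]; rewrite subUset !sub1set !xX cards2 (inj_eq x_inj) ij /=.
case/existsP=> e /andP[]; rewrite inE => /asboolP[c [r ->]] /eqP/setP cr.
exists c, r => k; have := cr (x k).
by rewrite !inE xX andbT !(inj_eq x_inj).
Qed.

Theorem theorem4 (d : nat) (hd : 1 <= d) (G : sgraph) :
  ~ minor (complete_graph d) G -> distance_vcdim2 G <= d - 1.
Proof.
move=> no_minor; apply/bigmax_leqP => S _; apply/bigmax_leqP => X shX.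
rewrite leqNgt; apply/negP => ltX; apply: no_minor.
have [|f mf] := @shattered2_model _ X d shX; first by lia.
(* Distances are those of the induced subgraph; only the resulting model is carried over to [G]. *)
by have [g mg] := model_induced mf; apply: complete_model_minor mg.
Qed.
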